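(* Let $X,Y$ be Banach spaces over $\mathbb{K}\in\{\mathbb{R},\mathbb{C}\}$, let $G\in L(X,Y)$ with $\|G\|=1$, and assume that $\|\cdot\|_G$ is a norm on $L(X,Y)$. Let $T\in L(X,Y)$ satisfy $\|T\|_G=1$. Let $\mathcal{W}(T)\subset L(X,Y)^*$ be the set of all weak*-limits of nets $(\psi_{x_\alpha,y_\alpha^*})$ where $(x_\alpha,y_\alpha^* )\subset S_X\times S_{Y^*}$ is a net with $\|Gx_\alpha\|\to1$ and $y_\alpha^*(Tx_\alpha)\to1$. The following are equivalent: (i) $T$ is a smooth point of the unit ball of $(L(X,Y),\|\cdot\|_G)$; (ii) $\mathcal{W}(T)=\{\varphi\}$ for a single functional $\varphi$ with $\varphi(T)=1$.
   Context: $S_X$ is the unit sphere of $X$, $Y^*$ the dual of $Y$. For $x\in X$, $y^*\in Y^*$, $\psi_{x,y^*}(S)=y^*(Sx)$ for $S\in L(X,Y)$. The $G$-norm is $\|T\|_G := \inf_{\delta>0}\sup\{\|Tx\|: x\in S_X,\ \|Gx\|>1-\delta\}$. $T$ with $\|T\|_G=1$ is a smooth point of the unit ball of $(L(X,Y),\|\cdot\|_G)$ if there is exactly one functional $f$ in the unit sphere of $(L(X,Y),\|\cdot\|_G)^*$ with $f(T)=1$. *)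

(* Defs.v *)
From HB Require Import structures.
From mathcomp Require Import all_boot all_order all_algebra.
From mathcomp Require Import all_classical all_reals all_analysis.
From mathcomp Require Import complex.

Set Implicit Arguments.
Unset Strict Implicit.
Unset Printing Implicit Defensive.

Import Order.TTheory GRing.Theory Num.Theory.
Import numFieldNormedType.Exports.
Local Open Scope classical_set_scope.
Local Open Scope ring_scope.

(* Generic setting: scalar field K (R or R[i]), a real type R of "norm values",
   and toR : K -> R reading a (real) norm value of K as an element of R
   (identity for K = R, real part for K = R[i]). *)
Section Defs.
Variables (R : realType) (K : numFieldType) (toR : K -> R).

Definition is_linear (X Y : normedModType K) (f : X -> Y) : Prop :=
  forall (a : K) (x y : X), f (a *: x + y) = a *: f x + f y.

Definition bounded_op (X Y : normedModType K) (f : X -> Y) : Prop :=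
  is_linear f /\ continuous f.

Definition unit_sphere (X : normedModType K) : set X := [set x | `|x| = 1].
Arguments unit_sphere : clear implicits.

Definition opnorm (X Y : normedModType K) (f : X -> Y) : R :=
  sup [set toR `|f x| | x in unit_sphere X].

Definition bounded_functional (Y : normedModType K) (g : Y -> K) : Prop :=
  (forall (a : K) (y z : Y), g (a *: y + z) = a * g y + g z) /\ continuous g.

Definition functional_norm (Y : normedModType K) (g : Y -> K) : R :=
  sup [set toR `|g y| | y in unit_sphere Y].

Definition dual_sphere (Y : normedModType K) : set (Y -> K) :=
  [set g | bounded_functional g /\ functional_norm g = 1].
Arguments dual_sphere : clear implicits.

Definition Gnorm (X Y : normedModType K) (G T : X -> Y) : R :=
  inf [set sup [set toR `|T x| | x in
                 [set x | x \in unit_sphere X /\ 1 - d < toR `|G x|]]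
      | d in [set d : R | 0 < d]].

Definition Gnorm_is_norm (X Y : normedModType K) (G : X -> Y) : Prop :=
  [/\ (forall S : X -> Y, bounded_op S -> Gnorm G S = 0 -> forall x, S x = 0),
      (forall (a : K) (S : X -> Y), bounded_op S ->
         Gnorm G (fun x => a *: S x) = toR `|a| * Gnorm G S) &
      (forall S U : X -> Y, bounded_op S -> bounded_op U ->
         Gnorm G (fun x => S x + U x) <= Gnorm G S + Gnorm G U)].

(* Linear functionals on L(X,Y) are represented by maps (X -> Y) -> K;
   only their values on L(X,Y) matter. *)
Definition Gdual_functional (X Y : normedModType K) (G : X -> Y)
    (f : (X -> Y) -> K) : Prop :=
  (forall (a : K) (S U : X -> Y), bounded_op S -> bounded_op U ->
     f (fun x => a *: S x + U x) = a * f S + f U) /\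
  (exists C : R, forall S, bounded_op S -> toR `|f S| <= C * Gnorm G S).

Definition Gdual_norm (X Y : normedModType K) (G : X -> Y)
    (f : (X -> Y) -> K) : R :=
  sup [set toR `|f S| | S in [set S | bounded_op S /\ Gnorm G S <= 1]].

Definition Gdual_sphere (X Y : normedModType K) (G : X -> Y) :
    set ((X -> Y) -> K) :=
  [set f | Gdual_functional G f /\ Gdual_norm G f = 1].

Definition smooth_point (X Y : normedModType K) (G T : X -> Y) : Prop :=
  Gnorm G T = 1 /\
  exists f, f \in Gdual_sphere G /\ f T = 1 /\
    forall g, g \in Gdual_sphere G -> g T = 1 ->
      forall S, bounded_op S -> g S = f S.

Definition directed (I : Type) (le : I -> I -> Prop) : Prop :=
  [/\ (forall i, le i i),
      (forall i j k, le i j -> le j k -> le i k),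
      (exists i : I, True) &
      (forall i j, exists k, le i k /\ le j k)].

Definition net_cvg (I : Type) (le : I -> I -> Prop) (V : numFieldType)
    (u : I -> V) (l : V) : Prop :=
  forall e : V, 0 < e -> exists i0, forall i, le i0 i -> `|u i - l| < e.

Definition psi (X Y : normedModType K) (x : X) (y' : Y -> K) :
    (X -> Y) -> K := fun S => y' (S x).

Definition W_set (X Y : normedModType K) (G T : X -> Y) :
    set ((X -> Y) -> K) :=
  [set phi | exists (I : Type) (le : I -> I -> Prop)
                    (xs : I -> X) (ys : I -> Y -> K),
     [/\ directed le,
         (forall i, xs i \in unit_sphere X /\ ys i \in dual_sphere Y),
         net_cvg le (fun i => toR `|G (xs i)|) 1,
         net_cvg le (fun i => ys i (T (xs i))) 1 &
         (forall S, bounded_op S ->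
            net_cvg le (fun i => psi (xs i) (ys i) S) (phi S))]].

Definition W_singleton (X Y : normedModType K) (G T : X -> Y)
    (phi : (X -> Y) -> K) : Prop :=
  phi \in W_set G T /\
  forall phi', phi' \in W_set G T -> forall S, bounded_op S -> phi' S = phi S.

Definition thm311_claim : Prop :=
  forall (X Y : completeNormedModType K) (G T : X -> Y),
    bounded_op G -> opnorm G = 1 -> Gnorm_is_norm G ->
    bounded_op T -> Gnorm G T = 1 ->
    (smooth_point G T <->
     exists phi : (X -> Y) -> K, W_singleton G T phi /\ phi T = 1).

End Defs.

(* Main.v *)
Require Import Defs.
From HB Require Import structures.
From mathcomp Require Import all_boot all_order all_algebra.
From mathcomp Require Import all_classical all_reals all_analysis.
From mathcomp Require Import complex.
From mathcomp Require Import ring lra.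

(** Every element of [W(T)] is a support functional of the unit ball at [T],
    and [W(T)] is nonempty, so smoothness forces it to be a singleton.
    Conversely let [g] be any support functional at [T] and [S] an operator.
    Then [1 + t Re g(S) <= ||T + t S||_G] for [t > 0]; choosing [x_t] almost
    attaining this norm with [||G x_t|| > 1 - t], and [y_t] norming
    [(T + t S) x_t] (Hahn-Banach), gives [y_t(T x_t) -> 1] and
    [Re y_t(S x_t) >= Re g(S) - O(t)].  A limit along an ultrafilter is an
    element [phi] of [W(T)] with [Re phi(S) >= Re g(S)].  If [W(T)] has a single
    element this holds for every [S] with the same [phi], and hence [g = phi]. *)

Set Implicit Arguments.
Unset Strict Implicit.
Unset Printing Implicit Defensive.

Import Order.TTheory GRing.Theory Num.Theory.
Import numFieldNormedType.Exports.
(* Imported again so that [Re] and [Im] denote [complex.Re] and [complex.Im]. *)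
Import complex.
Local Open Scope classical_set_scope.
Local Open Scope ring_scope.

(** * Hahn-Banach *)

Section HahnBanach.
Variables (R : realType) (V : lmodType R) (p : V -> R).
Hypothesis pD : forall x y, p (x + y) <= p x + p y.
Hypothesis pZ : forall (a : R) x, 0 < a -> p (a *: x) = a * p x.

(* Graphs of linear functionals dominated by [p], defined on subspaces.  That
   such a set is single-valued follows from [p 0 = 0]. *)
Definition dominated_graph (A : set (V * R)) : Prop :=
  (forall a v r w s, A (v, r) -> A (w, s) -> A (a *: v + w, a * r + s)) /\
  (forall v r, A (v, r) -> r <= p v).

Let p0 : p 0 = 0.
Proof.
have := pZ 0 (ltr0n R 2 : 0 < 2%:R); rewrite scaler0 => h; lra.
Qed.

(** The graph contains both [(0, r - s)] and [(0, s - r)], and domination by [p 0 = 0] makes both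
    differences nonpositive. *)
Lemma dominated_graph_fun (A : set (V * R)) v r s :
  dominated_graph A -> A (v, r) -> A (v, s) -> r = s.
Proof.
move=> [lin dom] Ar As; apply/eqP; rewrite eq_le -subr_le0 -(subr_le0 r).
have := dom _ _ (lin (-1) _ _ _ _ As Ar).
have := dom _ _ (lin (-1) _ _ _ _ Ar As).
by rewrite !scaleN1r !addNr p0 !mulN1r ![- _ + _]addrC => -> ->.
Qed.

(** The value [c] at [v1] must satisfy [r - p (v - v1) <= c <= p (w + v1) - s] for all [(v, r)] and
    [(w, s)] in [A]. Subadditivity puts every lower bound below every upper bound, so the supremum
    of the lower bounds is admissible. *)
Lemma dominated_graph_extend (A : set (V * R)) (v1 : V) :
  dominated_graph A -> A (0, 0) ->
  exists B, [/\ dominated_graph B, A `<=` B & exists c, B (v1, c)].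
Proof.
move=> [lin dom] A0.
have AZ a v r : A (v, r) -> A (a *: v, a * r).
  by move=> Av; have := lin a _ _ _ _ Av A0; rewrite !addr0.
pose E := [set x.2 - p (x.1 - v1) | x in A].
have Eub v r : A (v, r) -> ubound E (p (v + v1) - r).
  move=> Av _ [[w s] Aw <-] /=.
  have := dom _ _ (lin 1 _ _ _ _ Av Aw).
  have := pD (v + v1) (w - v1).
  rewrite scale1r mul1r addrACA subrr addr0; lra.
have Ene : E !=set0 by exists (0 - p (0 - v1)), (0, 0).
pose c := sup E.
have c_ge v r : A (v, r) -> r - p (v - v1) <= c.
  move=> Av; apply: ub_le_sup; last by exists (v, r).
  by exists (p (0 + v1) - 0); exact: Eub.
have c_le v r : A (v, r) -> c <= p (v + v1) - r.
  by move=> Av; apply: ge_sup => //; exact: Eub.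
pose B := [set z | exists v r t, A (v, r) /\ z = (v + t *: v1, r + t * c)].
exists B; split.
- split.
  + move=> a _ _ _ _ [v [r [t [Av [-> ->]]]]] [w [s [u [Aw [-> ->]]]]].
    exists (a *: v + w), (a * r + s), (a * t + u); split; first exact: lin.
    congr pair; last by ring.
    by rewrite scalerDr scalerDl scalerA addrACA.
  + move=> _ _ [v [r [t [Av [-> ->]]]]].
    (* Dividing by [|t|] reduces domination at [v + t *: v1] to the two bounds on [c], by positive
       homogeneity. *)
    have [t0|t0|->] := ltgtP t 0; last first.
    * by rewrite scale0r mul0r !addr0; exact: dom.
    * have := c_le _ _ (AZ t^-1 _ _ Av).
      rewrite -(ler_pM2l t0) mulrBr mulrA divff ?gt_eqF// mul1r.
      rewrite -(pZ _ t0) scalerDr scalerA divff ?gt_eqF// scale1r; lra.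
    * have nt0 : 0 < - t by rewrite oppr_gt0.
      have := c_ge _ _ (AZ (- t)^-1 _ _ Av).
      rewrite -(ler_pM2l nt0) mulrBr mulrA divff ?gt_eqF// mul1r.
      rewrite -(pZ _ nt0) scalerBr scalerA divff ?gt_eqF// scale1r.
      by rewrite scaleNr opprK; lra.
- by move=> [v r] Av; exists v, r, 0; rewrite scale0r mul0r !addr0.
- by exists c, 0, 0, 1; rewrite scale1r mul1r !add0r.
Qed.

Theorem Hahn_Banach_support (v0 : V) :
  exists f : {scalar V}, (forall v, f v <= p v) /\ f v0 = p v0.
Proof.
(* The point [(v0, p v0)] is required only of nonempty graphs, because the union of the empty chain
   must satisfy [P] as well. *)
pose P (A : set (V * R)) :=
  dominated_graph A /\ forall z, A z -> A (v0, p v0).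
have [|A [[gA A0] Amax]] := @Zorn_bigcup _ P.
  move=> F FP Ftot; split; last first.
    by move=> z [B FB Bz]; exists B => //; exact: (FP B FB).2 Bz.
  split => [a v r w s [B FB Bv] [C FC Cw]|v r [B FB Bv]].
    have [BC|CB] := Ftot _ _ FB FC.
      by exists C => //; apply: (FP C FC).1.1 => //; exact: BC.
    by exists B => //; apply: (FP B FB).1.1 => //; exact: CB.
  exact: (FP B FB).1.2 Bv.
have Av0 : A (v0, p v0).
  have [A00|/set0P[z /A0//]] := eqVneq A set0.
  (* The empty graph is not maximal, being contained in the line through [(v0, p v0)]. For [a < 0]
     that line is dominated because [0 = p 0 <= p (a *: v0) + p ((- a) *: v0)]. *)
  exfalso; pose L := [set z | exists a, z = (a *: v0, a * p v0)].
  have PL : P L.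
    split; last by move=> _ _; exists 1; rewrite scale1r mul1r.
    split => [a _ _ _ _ [b [-> ->]] [c [-> ->]]|_ _ [a [-> ->]]].
      by exists (a * b + c); rewrite scalerDl scalerA mulrDl mulrA.
    have [a0|a0|->] := ltgtP a 0; last by rewrite scale0r mul0r p0.
      have na0 : 0 < - a by rewrite oppr_gt0.
      have := pD (a *: v0) ((- a) *: v0).
      by rewrite (pZ _ na0) scaleNr subrr p0; lra.
    by rewrite pZ.
  apply: (Amax L) => //; rewrite A00; split => // /(_ (v0, p v0)); apply.
  by exists 1; rewrite scale1r mul1r.
have Atot v : exists r, A (v, r).
  have A00 : A (0, 0).
    by have := gA.1 (-1) _ _ _ _ Av0 Av0; rewrite scaleN1r mulN1r !addNr.
  have [B [gB AB [c Bc]]] := dominated_graph_extend v gA A00.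
  have [eAB|neAB] := pselect (A = B); first by exists c; rewrite eAB.
  exfalso; apply: (Amax B); last by split => // _ _; exact: AB.
  by split => // BA; apply: neAB; apply/seteqP.
pose f v := sval (cid (Atot v)).
have fA v : A (v, f v) by rewrite /f; case: cid.
have flin : scalar f.
  move=> a v w; apply: (dominated_graph_fun gA (fA _)).
  exact: gA.1.
pose F : {scalar V} := HB.pack f (GRing.isLinear.Build R V R *%R f flin).
exists F; split => [v|]; first exact: gA.2 (fA v).
exact: dominated_graph_fun gA (fA v0) Av0.
Qed.
End HahnBanach.

(** * Real and complex scalars *)

(** A copy of [V] indexed by [f], so that the module structure over [A] does not clash with the one
    over [B]. *)
Definition restrict_scalars (A B : pzRingType) (f : {rmorphism A -> B})
  (V : lmodType B) : Type := V.

Section RestrictScalars.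
Variables (A B : pzRingType) (f : {rmorphism A -> B}) (V : lmodType B).
Local Notation W := (restrict_scalars f V).

HB.instance Definition _ := GRing.Zmodule.copy W V.

Let rscale (a : A) (v : W) : W := f a *: (v : V).

Let rscaleA a b v : rscale a (rscale b v) = rscale (a * b) v.
Proof. by rewrite /rscale scalerA rmorphM. Qed.

Let rscale1 : left_id 1 rscale.
Proof. by move=> v; rewrite /rscale rmorph1 scale1r. Qed.

Let rscaleDr : right_distributive rscale +%R.
Proof. by move=> a v w; rewrite /rscale scalerDr. Qed.

Let rscaleDl v : {morph rscale^~ v : a b / a + b}.
Proof. by move=> a b; rewrite /rscale rmorphD scalerDl. Qed.

HB.instance Definition _ :=
  GRing.Zmodule_isLmodule.Build A W rscaleA rscale1 rscaleDr rscaleDl.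

Lemma restrict_scalarsZ (a : A) (v : W) : a *: v = f a *: (v : V) :> V.
Proof. by []. Qed.

End RestrictScalars.

(* What the proof uses of the scalar field [K] being [R] or [R[i]], with [re]
   the identity or the real part. *)
Record real_part (R : realType) (K : numFieldType) (re : K -> R) := RealPart {
  emb : {rmorphism R -> K};
  reD : forall z w, re (z + w) = re z + re w;
  re_embM : forall a z, re (emb a * z) = a * re z;
  re1 : re 1 = 1;
  emb_ge0 : forall a, 0 <= a -> 0 <= emb a;
  le_re : forall z w, z <= w -> re z <= re w;
  emb_re : forall z, 0 <= z -> emb (re z) = z;
  re_le_norm : forall z, re z <= re `|z|;
  re_norm_eq : forall z, re `|z| <= re z -> z = `|z|;
  re_ultra_cvg : forall (U : set_system nat) (u : nat -> K) (M : R),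
    UltraFilter U -> (forall n, re `|u n| <= M) ->
    exists l, forall e : R, 0 < e -> U [set n | re `|u n - l| < e];
  re_lift : forall (V : lmodType K) (f : {scalar restrict_scalars emb V}),
    exists g : {scalar V}, forall v, re (g v) = f v }.

(** * Limits of bounded sequences along ultrafilters *)

Lemma fmap_ultra (S T : Type) (f : S -> T) (U : set_system S) :
  UltraFilter U -> UltraFilter (f @ U).
Proof.
move=> UU; split; first exact: fmap_proper_filter.
move=> G GF UG; apply/seteqP; split => // A GA.
have [//|UnA] := in_ultra_setVsetC (f @^-1` A) UU.
have GnA : G (~` A) by exact: UG.
by exfalso; apply: (@filter_not_empty _ G); rewrite -(setICr A); exact: filterI.
Qed.

Lemma ultra_bounded_cvg (R : realType) (U : set_system nat) (u : nat -> R)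
    (M : R) :
  UltraFilter U -> (forall n, `|u n| <= M) ->
  exists l, forall e : R, 0 < e -> U [set n | `|u n - l| < e].
Proof.
move=> UU uM.
have := @segment_compact R (- M) M; rewrite compact_ultra /= => cptM.
have uU : (u @ U) [set` `[- M, M]].
  have uMi n : u n \in `[- M, M] by rewrite in_itv/= -ler_norml.
  by apply: (@filterS _ U _ setT) => [n _|]; [exact: uMi|exact: filterT].
have uUU : UltraFilter (u @ U) by exact: fmap_ultra.
have [l [_ ul]] := cptM _ uUU uU.
exists l => e e0; have := ul (ball l e) (nbhsx_ballx _ _ e0).
by apply: (@filterS _ U) => n; rewrite -ball_normE /= distrC.
Qed.

Lemma real_part_real (R : realType) : real_part (@id R).
Proof.
have lift (V : lmodType R)
    (f : {scalar restrict_scalars (idfun : {rmorphism R -> R}) V}) :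
    exists g : {scalar V}, forall v, g v = f v.
  have flin : scalar (f : V -> R) by move=> a v w; exact: linearP f a v w.
  pose g : {scalar V} :=
    HB.pack (f : V -> R) (GRing.isLinear.Build R V R *%R (f : V -> R) flin).
  by exists g.
apply: (@RealPart R R id (idfun : {rmorphism R -> R})) => //.
- by move=> z; exact: ler_norm.
- by move=> z /(le_trans (normr_ge0 z))/ger0_norm ->.
- exact: ultra_bounded_cvg.
Qed.

Section ComplexRealPart.
Local Open Scope complex_scope.

Lemma real_part_complex (R : realType) : real_part (@Re R).
Proof.
pose C := R[i].
have ren (z : C) : Re `|z| = Num.sqrt (Re z ^+ 2 + Im z ^+ 2) by rewrite normc_def.
have lift (V : lmodType C)
    (f : {scalar restrict_scalars (real_complex R : {rmorphism R -> C}) V}) :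
    exists g : {scalar V}, forall v, Re (g v) = f v.
  have fD v w : f (v + w) = f v + f w by exact: raddfD.
  have fZ (a : R) v : f (a%:C *: v : V) = a * f v by exact: linearZ.
  (* A complex-linear functional is recovered from its real part [f] by [g v = f v - i f (i v)]. *)
  pose g (v : V) : C := (f v +i* - f ('i *: v : V))%C.
  have glin : scalar g.
    move=> [a b] v w; rewrite /g.
    have -> : f ((a +i* b)%C *: v + w : V) = a * f v + b * f ('i *: v : V) + f w.
      rewrite fD; congr (_ + _).
      have -> : (a +i* b)%C *: v = a%:C *: v + b%:C *: ('i *: v).
        by rewrite scalerA -scalerDl; congr (_ *: _); simpc.
      by rewrite fD !fZ.
    have -> : f ('i *: ((a +i* b)%C *: v + w) : V) =
        a * f ('i *: v : V) - b * f v + f ('i *: w : V).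
      rewrite scalerDr fD; congr (_ + _).
      have -> : 'i *: ((a +i* b)%C *: v) = a%:C *: ('i *: v) + (- b)%:C *: v.
        by rewrite !scalerA -scalerDl; congr (_ *: _); simpc.
      by rewrite fD !fZ mulNr.
    by apply/eqP; rewrite eq_complex /=; apply/andP; split; apply/eqP; ring.
  pose h : {scalar V} := HB.pack g (GRing.isLinear.Build C V C *%R g glin).
  by exists h.
apply: (@RealPart R C (@Re R) (real_complex R : {rmorphism R -> C})) => //.
- by move=> [a b] [c d].
- by move=> a [c d] /=; rewrite mul0r subr0.
- by move=> a a0; rewrite lecR.
- by move=> z w; rewrite lecE => /andP[].
- by move=> z z0; apply: RRe_real; exact: ger0_real.
- move=> z; rewrite ren (le_trans (ler_norm _))// -sqrtr_sqr ler_wsqrtr//.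
  by rewrite lerDl sqr_ge0.
- move=> z; rewrite ren => h.
  have s0 := sqrtr_ge0 (Re z ^+ 2 + Im z ^+ 2).
  have s2 : Num.sqrt (Re z ^+ 2 + Im z ^+ 2) ^+ 2 = Re z ^+ 2 + Im z ^+ 2.
    by rewrite sqr_sqrtr// addr_ge0 ?sqr_ge0.
  (* Squaring [h] gives [Re z ^+ 2 + Im z ^+ 2 <= Re z ^+ 2]. *)
  have z0 : Im z = 0.
    apply/eqP; rewrite -sqrf_eq0 eq_le sqr_ge0 andbT.
    have := ler_pM s0 s0 h h; rewrite -!expr2 s2; lra.
  apply/eqP; rewrite eq_complex normc_def /= z0 expr0n addr0 sqrtr_sqr eqxx andbT.
  by rewrite ger0_norm// (le_trans s0 h).
- move=> U u M UU uM.
  have sle (z : C) : `|Re z| <= Re `|z| /\ `|Im z| <= Re `|z|.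
    by rewrite ren -!sqrtr_sqr !ler_wsqrtr ?lerDl ?lerDr ?sqr_ge0.
  have [a ua] := ultra_bounded_cvg UU (fun n => le_trans (sle (u n)).1 (uM n)).
  have [b ub] := ultra_bounded_cvg UU (fun n => le_trans (sle (u n)).2 (uM n)).
  exists (a +i* b)%C => e e0; have e20 : 0 < e / 2 by rewrite divr_gt0.
  apply: (filterS _ (filterI (ua _ e20) (ub _ e20))) => n [/= h1 h2].
  change (Re `|u n - (a +i* b)| < e).
  rewrite ren -[ltRHS]gtr0_norm// -sqrtr_sqr ltr_sqrt ?exprn_gt0//.
  have -> : Re (u n - (a +i* b)) = Re (u n) - a by case: (u n).
  have -> : Im (u n - (a +i* b)) = Im (u n) - b by case: (u n).
  rewrite -[X in X + _]real_normK ?num_real// -[X in _ + X]real_normK ?num_real//.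
  have := normr_ge0 (Re (u n) - a); have := normr_ge0 (Im (u n) - b); nra.
Qed.

End ComplexRealPart.

(** * Norms as real numbers *)

(** Closes the limit arguments below, with [C] collecting all the error terms. A positive [x] is
    refuted by [e = x / (2 (|C| + 1))]. *)
Lemma le0_of_le_eps (R : realFieldType) (x C : R) :
  (forall e, 0 < e -> x <= C * e) -> x <= 0.
Proof.
move=> h; rewrite leNgt; apply/negP => x0.
have C0 : 0 < `|C| + 1 by rewrite ltr_wpDl.
set q := x / (`|C| + 1); have q0 : 0 < q by rewrite divr_gt0.
have xq : x = q * (`|C| + 1) by rewrite divfK ?gt_eqF.
have := h _ (divr_gt0 q0 (ltr0n _ 2)).
have := ler_wpM2r (ltW q0) (ler_norm C); lra.
Qed.

Section RealPartNorm.
Variables (R : realType) (K : numFieldType) (re : K -> R) (rp : real_part re).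
Local Notation emb := (emb rp).
Local Notation nrm x := (re `|x|).

Lemma re0 : re 0 = 0.
Proof. by rewrite -[X in re X](mul0r 0) -(rmorph0 emb) re_embM mul0r. Qed.

Lemma reN z : re (- z) = - re z.
Proof. by apply/eqP; rewrite -subr_eq0 opprK -(reD rp) addNr re0. Qed.

Lemma re_emb a : re (emb a) = a.
Proof. by rewrite -[emb a]mulr1 re_embM (re1 rp) mulr1. Qed.

Lemma re_ge0 z : 0 <= z -> 0 <= re z.
Proof. by move=> /(le_re rp); rewrite re0. Qed.

Lemma reM_ge0 z w : 0 <= z -> re (z * w) = re z * re w.
Proof. by move=> z0; rewrite -{1}(emb_re rp z0) re_embM. Qed.

Lemma ler_re z w : 0 <= z -> 0 <= w -> (z <= w) = (re z <= re w).
Proof.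
move=> z0 w0; apply/idP/idP; first exact: le_re.
rewrite -subr_ge0 => h; rewrite -subr_ge0 -(emb_re rp z0) -(emb_re rp w0) -rmorphB.
exact: emb_ge0.
Qed.

Lemma ltr_re z w : 0 <= z -> 0 <= w -> (z < w) = (re z < re w).
Proof.
move=> z0 w0; rewrite lt_def [in RHS]lt_def ler_re//; congr (~~ _ && _).
by apply/eqP/eqP => [->//|h]; rewrite -(emb_re rp z0) -(emb_re rp w0) h.
Qed.

Section NormedZmod.
Variable V : normedZmodType K.
Implicit Types x y : V.

Lemma nrm_ge0 x : 0 <= nrm x.
Proof. exact/re_ge0/normr_ge0. Qed.

Lemma nrm_triangle x y : nrm (x + y) <= nrm x + nrm y.
Proof. by rewrite -(reD rp); apply: (le_re rp); exact: ler_normD. Qed.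

Lemma nrm0 : nrm (0 : V) = 0.
Proof. by rewrite normr0 re0. Qed.

Lemma nrm_eq0 x : (nrm x == 0) = (x == 0).
Proof.
apply/eqP/eqP => [h|->]; last exact: nrm0.
by apply/eqP; rewrite -normr_eq0 -(emb_re rp (normr_ge0 x)) h rmorph0.
Qed.

Lemma nrm_gt0 x : (0 < nrm x) = (x != 0).
Proof. by rewrite lt_def nrm_eq0 nrm_ge0 andbT. Qed.

Lemma nrmE x : `|x| = emb (nrm x).
Proof. by rewrite (emb_re rp). Qed.
End NormedZmod.

Lemma nrmM (z w : K) : nrm (z * w) = nrm z * nrm w.
Proof. by rewrite normrM reM_ge0. Qed.

Lemma nrm1 : nrm (1 : K) = 1.
Proof. by rewrite normr1 (re1 rp). Qed.

Lemma nrmZ (V : normedModType K) a (x : V) : nrm (a *: x) = nrm a * nrm x.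
Proof. by rewrite normrZ reM_ge0. Qed.

Lemma nrm_emb a : 0 <= a -> nrm (emb a) = a.
Proof. by move=> a0; rewrite ger0_norm ?re_emb//; exact: emb_ge0. Qed.

(** Rotating by [c] turns bounds on real parts of linear functionals into bounds on absolute
    values. *)
Lemma exists_phase (z : K) :
  exists2 c : K, nrm c = 1 & re (c * z) = nrm z.
Proof.
have [->|z0] := eqVneq z 0; first by exists 1; rewrite ?nrm1// mulr0 normr0.
exists (`|z| / z); last by rewrite divfK.
by rewrite normrM normfV normr_id divff ?normr_eq0// (re1 rp).
Qed.

Lemma normalize (V : normedModType K) (y : V) : y != 0 ->
  exists2 u, unit_sphere u & y = emb (nrm y) *: u.
Proof.
move=> y0; have y1 : `|y| != 0 by rewrite normr_eq0.
exists (`|y|^-1 *: y).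
  by rewrite /unit_sphere /= normrZ normfV normr_id mulVf.
by rewrite -nrmE scalerA divff// scale1r.
Qed.

(** * Bounded linear operators *)

Section LinearMaps.
Variables V W : normedModType K.

Lemma linear_continuous_le (f : {linear V -> W}) : continuous f ->
  exists2 M : R, 0 <= M & forall x, nrm (f x) <= M * nrm x.
Proof.
move=> /linear_bounded_continuous/linear_boundedP/pinfty_ex_gt0[r r0 fr].
exists (re r); first exact/re_ge0/ltW.
by move=> x; rewrite -(reM_ge0 _ (ltW r0)); exact: (le_re rp (fr x)).
Qed.

Lemma le_linear_continuous (f : {linear V -> W}) :
  (forall x, nrm (f x) <= nrm x) -> continuous f.
Proof.
move=> fr; apply/linear_bounded_continuous/linear_boundedP; near=> r => x.
apply: (@le_trans _ _ `|x|); first by rewrite ler_re.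
by rewrite ler_peMl//; near: r; exact: nbhs_pinfty_ge.
Unshelve. all: by end_near. Qed.

Lemma bounded_op_le (S : V -> W) : bounded_op S ->
  exists2 M : R, 0 <= M & forall x, nrm (S x) <= M * nrm x.
Proof.
move=> [lin cS].
pose f : {linear V -> W} := HB.pack S (GRing.isLinear.Build K V W *:%R S lin).
exact: (@linear_continuous_le f cS).
Qed.

Lemma bounded_opD (S U : V -> W) : bounded_op S -> bounded_op U ->
  bounded_op (fun x => S x + U x).
Proof.
move=> [lS cS] [lU cU]; split => [a x y|x]; last exact: cvgD (cS x) (cU x).
by rewrite lS lU scalerDr addrACA.
Qed.

Lemma bounded_opZ a (S : V -> W) : bounded_op S -> bounded_op (fun x => a *: S x).
Proof.
move=> [lS cS]; split => [b x y|x]; last exact: cvgZr (cS x).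
by rewrite lS scalerDr !scalerA mulrC.
Qed.

Lemma bounded_op0 : bounded_op (fun _ : V => 0 : W).
Proof. by split => [a x y|x]; [rewrite scaler0 addr0|exact: cvg_cst]. Qed.

End LinearMaps.

(** * The dual sphere and norming functionals *)

Section Functionals.
Variable Y : normedModType K.

Lemma bounded_functional_le (g : Y -> K) : bounded_functional g ->
  exists2 M : R, 0 <= M & forall y, nrm (g y) <= M * nrm y.
Proof.
move=> [lin cg].
pose f : {linear Y -> K^o} := HB.pack (g : Y -> K^o)
  (GRing.isLinear.Build K Y K^o *:%R (g : Y -> K^o) lin).
exact: (@linear_continuous_le _ _ f cg).
Qed.

Lemma dual_sphere_le (g : Y -> K) y : dual_sphere re g -> nrm (g y) <= nrm y.
Proof.
move=> [bg ng]; have [lin _] := bg.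
have g0 : g 0 = 0 by have := lin (-1) 0 0; rewrite scaler0 addr0 mulN1r addNr.
have gZ a z : g (a *: z) = a * g z by rewrite -[a *: z]addr0 lin g0 addr0.
have [->|y0] := eqVneq y 0; first by rewrite g0 !normr0.
(* The bound [M] makes the supremum in [functional_norm] a genuine one, so that [nrm (g u)] lies
   below it. *)
have [M M0 gM] := bounded_functional_le bg.
have [u u1 ->] := normalize y0.
rewrite gZ nrmM nrmZ ler_wpM2l ?nrm_ge0// u1 (re1 rp) -ng.
apply: ub_le_sup; last by exists u.
by exists M => _ [z z1 <-]; rewrite (le_trans (gM z))// z1 (re1 rp) mulr1.
Qed.

(** The real Hahn-Banach theorem with [p] the norm gives a real functional supporting [p] at [y],
    which [re_lift] makes [K]-linear. A phase turns domination of the real part into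
    [nrm (g v) <= nrm v], with equality at the normalized [y]. *)
Lemma norming_functional (y : Y) : y != 0 ->
  exists2 g : Y -> K, dual_sphere re g & re (g y) = nrm y.
Proof.
move=> y0.
pose V := restrict_scalars emb Y.
pose p (v : V) : R := nrm (v : Y).
have [|a v a0|f [fp fy]] := @Hahn_Banach_support R V p _ _ y.
- by move=> v w; exact: nrm_triangle.
- by rewrite /p restrict_scalarsZ nrmZ nrm_emb// ltW.
have [g gf] := re_lift f.
have gle v : nrm (g v) <= nrm v.
  have [c c1 <-] := exists_phase (g v).
  rewrite -[c * _]/(c *: _) -linearZ /= gf (le_trans (fp _))// /p.
  by rewrite (nrmZ c (v : Y)) c1 mul1r.
exists g; last by rewrite gf fy.
have bg : bounded_functional g.
  split; first exact: linearP.
  pose h : {linear Y -> K^o} := HB.pack (g : Y -> K^o)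
    (GRing.isLinear.Build K Y K^o *:%R (g : Y -> K^o) (linearP g)).
  exact: (@le_linear_continuous _ _ h gle).
have [u u1 yu] := normalize y0.
have gub : ubound [set nrm (g z) | z in @unit_sphere K Y] 1.
  by move=> _ [z z1 <-]; rewrite (le_trans (gle z))// z1 (re1 rp).
split => //; apply/eqP; rewrite eq_le; apply/andP; split.
  by apply: ge_sup => //; exists (nrm (g u)), u.
apply: (@le_trans _ _ (nrm (g u))); last by apply: ub_le_sup; [exists 1|exists u].
rewrite -(ler_pM2l (_ : 0 < nrm y)) ?nrm_gt0// mulr1.
rewrite -{2}(nrm_emb (nrm_ge0 y)) -nrmM -[emb _ * _]/(emb _ *: _) -linearZ -yu.
by rewrite -[leLHS]fy -gf re_le_norm.
Qed.
End Functionals.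
End RealPartNorm.

(** * Nets *)

Section Nets.
Variables (R : realType) (K : numFieldType) (re : K -> R) (rp : real_part re).
Local Notation nrm x := (re `|x|).

(** In [net_cvg] the tolerance is a positive element of [K]; [emb] and [re] exchange it with a
    positive real. *)
Lemma net_cvgP (I : Type) (le : I -> I -> Prop) (u : I -> K) (l : K) :
  net_cvg le u l <->
  forall e : R, 0 < e -> exists i0, forall i, le i0 i -> nrm (u i - l) < e.
Proof.
split => h e e0.
  have ee : 0 <= emb rp e by apply: emb_ge0; exact: ltW.
  have [|i0 hi0] := h (emb rp e).
    by rewrite (ltr_re rp (lexx 0) ee) (re0 rp) re_emb.
  by exists i0 => i /hi0; rewrite (ltr_re rp (normr_ge0 _) ee) re_emb.
have [|i0 hi0] := h (re e).
  by rewrite -(re0 rp) -(ltr_re rp (lexx 0) (ltW e0)).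
by exists i0 => i /hi0; rewrite (ltr_re rp (normr_ge0 _) (ltW e0)).
Qed.

Lemma net_eventually_and (I : Type) (le : I -> I -> Prop) (P Q : I -> Prop) :
  directed le ->
  (exists i0, forall i, le i0 i -> P i) -> (exists i0, forall i, le i0 i -> Q i) ->
  exists i0, forall i, le i0 i -> P i /\ Q i.
Proof.
move=> [_ tr _ dir] [i Pi] [j Qj]; have [k [ik jk]] := dir i j.
by exists k => l kl; split; [apply/Pi/(tr _ _ _ ik)|apply/Qj/(tr _ _ _ jk)].
Qed.

Lemma net_cvg_unique (I : Type) (le : I -> I -> Prop) (u : I -> K) (l m : K) :
  directed le -> net_cvg le u l -> net_cvg le u m -> l = m.
Proof.
move=> dle /net_cvgP ul /net_cvgP um; apply/eqP.
rewrite -subr_eq0 -(nrm_eq0 rp) eq_le (nrm_ge0 rp) andbT.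
apply: (@le0_of_le_eps _ _ 2) => e e0.
have [i0 hi] := net_eventually_and dle (ul e e0) (um e e0).
have [refl _ _ _] := dle; have [h1 h2] := hi i0 (refl i0).
have -> : l - m = (u i0 - m) + (- (u i0 - l)) by ring.
by rewrite (le_trans (nrm_triangle rp _ _))// normrN; lra.
Qed.

Lemma net_cvg_linear (I : Type) (le : I -> I -> Prop) (a : K) (u v : I -> K) l m :
  directed le -> net_cvg le u l -> net_cvg le v m ->
  net_cvg le (fun i => a * u i + v i) (a * l + m).
Proof.
move=> dle /net_cvgP ul /net_cvgP um; apply/net_cvgP => e e0.
have a0 := nrm_ge0 rp a.
(* With this tolerance [d] for both nets the total error is below [nrm a * d + d = e], also when
   [a = 0]. *)
have d0 : 0 < e / (nrm a + 1) by rewrite divr_gt0// ltr_wpDl.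
have [i0 hi] := net_eventually_and dle (ul _ d0) (um _ d0).
exists i0 => i /hi [h1 h2].
have -> : a * u i + v i - (a * l + m) = a * (u i - l) + (v i - m) by ring.
rewrite (le_lt_trans (nrm_triangle rp _ _))// (nrmM rp).
have eE : e = nrm a * (e / (nrm a + 1)) + e / (nrm a + 1).
  by rewrite -[X in _ + X]mul1r -mulrDl mulrC divfK// gt_eqF// ltr_wpDl.
by rewrite [ltRHS]eE ler_ltD// ler_wpM2l// ltW.
Qed.

Lemma net_cvg_le (I : Type) (le : I -> I -> Prop) (u : I -> K) l (c : R) :
  directed le -> net_cvg le u l ->
  (exists i0, forall i, le i0 i -> nrm (u i) <= c) -> nrm l <= c.
Proof.
move=> dle /net_cvgP ul uc; rewrite -subr_le0.
apply: (@le0_of_le_eps _ _ 1) => e e0; rewrite mul1r.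
have [i0 hi] := net_eventually_and dle (ul e e0) uc.
have [refl _ _ _] := dle; have [h1 h2] := hi i0 (refl i0).
have := nrm_triangle rp (u i0) (- (u i0 - l)).
by rewrite normrN opprB addrCA subrr addr0; lra.
Qed.

(* The canonical net of a filter [U]: pairs of a member of [U] and a point of
   it, ordered by reverse inclusion of the members. *)
Definition filter_index (T : Type) (U : set_system T) : Type :=
  {p : set T * T | U p.1 /\ p.1 p.2}.

Definition filter_index_le (T : Type) (U : set_system T)
    (p q : filter_index U) : Prop := (sval q).1 `<=` (sval p).1.

Lemma filter_index_directed (T : Type) (U : set_system T) :
  ProperFilter U -> directed (@filter_index_le T U).
Proof.
move=> PU; have idx A : U A -> exists p : filter_index U, (sval p).1 = A.
  move=> UA; have [x Ax] := filter_ex UA.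
  by exists (exist (fun p : set T * T => U p.1 /\ p.1 p.2) (A, x) (conj UA Ax)).
split.
- by move=> p.
- by move=> p q r pq qr; exact: subset_trans qr pq.
- by have [p _] := idx setT filterT; exists p.
- move=> [[A x] [/= UA Ax]] [[B y] [/= UB By]].
  have [p pE] := idx _ (filterI UA UB).
  by exists p; rewrite /filter_index_le pE /=; split => z [].
Qed.

Lemma filter_index_eventually (T : Type) (U : set_system T) (A : set T) :
  ProperFilter U -> U A ->
  exists i0 : filter_index U, forall i, filter_index_le i0 i -> A (sval i).2.
Proof.
move=> PU UA; have [x Ax] := filter_ex UA.
exists (exist (fun p : set T * T => U p.1 /\ p.1 p.2) (A, x) (conj UA Ax)).
by move=> [[B y] [/= UB By]] /=; apply.
Qed.

End Nets.

(** * The G-norm and its support functionals *)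

Section GNorm.
Variables (R : realType) (K : numFieldType) (re : K -> R) (rp : real_part re).
Variables (X Y : normedModType K) (G : X -> Y).
Hypotheses (bG : bounded_op G) (G1 : opnorm re G = 1).
Local Notation nrm x := (re `|x|).
Local Notation Gn := (Gnorm re G).
Implicit Types (S T U : X -> Y) (c d e : R).

Lemma opnorm1_le x : unit_sphere x -> nrm (G x) <= 1.
Proof.
move=> x1; rewrite -G1; apply: ub_le_sup; last by exists x.
have [M M0 GM] := bounded_op_le rp bG.
by exists M => _ [z z1 <-]; rewrite (le_trans (GM z))// z1 (re1 rp) mulr1.
Qed.

Definition slice (d : R) : set X :=
  [set x | x \in @unit_sphere K X /\ 1 - d < nrm (G x)].

Lemma slice_nonempty d : 0 < d -> slice d !=set0.
Proof.
move=> d0.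
have [|_ [x x1 <-] h] :=
    @sup_adherent R [set nrm (G x) | x in @unit_sphere K X] d d0.
  split.
    (* Since [sup set0 = 0], the hypothesis [opnorm re G = 1] excludes an empty unit sphere. *)
    apply/set0P/negP => /eqP E0; move: G1; rewrite /opnorm E0 sup0 => /eqP.
    by rewrite eq_sym oner_eq0.
  by exists 1 => _ [x x1 <-]; exact: opnorm1_le.
by exists x; split; [rewrite inE|move: h; rewrite -/(opnorm re G) G1].
Qed.

(** Guarantees that the suprema in [Gnorm] are genuine and not the default value of [sup]. *)
Lemma slice_has_sup S d : bounded_op S -> 0 < d ->
  has_sup [set nrm (S x) | x in slice d].
Proof.
move=> bS d0; split; first by have [x sx] := slice_nonempty d0; exists (nrm (S x)), x.
have [M M0 SM] := bounded_op_le rp bS.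
exists M => _ [z [/set_mem z1 _] <-].
by rewrite (le_trans (SM z))// z1 (re1 rp) mulr1.
Qed.

Lemma Gnorm_le_sup S d : bounded_op S -> 0 < d ->
  Gn S <= sup [set nrm (S x) | x in slice d].
Proof.
move=> bS d0; apply: ge_inf; last by exists d.
exists 0 => _ [e e0 <-].
have [x sx] := slice_nonempty e0.
rewrite (le_trans (nrm_ge0 rp (S x)))//; apply: ub_le_sup; last by exists x.
exact: (slice_has_sup bS e0).2.
Qed.

Lemma Gnorm_approx S c d : bounded_op S -> c < Gn S -> 0 < d ->
  exists2 x, slice d x & c < nrm (S x).
Proof.
move=> bS cS d0; have := lt_le_trans cS (Gnorm_le_sup bS d0).
by move=> /(sup_gt (slice_has_sup bS d0).1)[_ [x sx <-] cx]; exists x.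
Qed.

Lemma Gnorm_lt_slice S c : bounded_op S -> Gn S < c ->
  exists2 d, 0 < d & forall x, slice d x -> nrm (S x) < c.
Proof.
move=> bS Sc.
have [|_ [d d0 <-] h] := inf_lt _ Sc.
  by exists (sup [set nrm (S x) | x in slice 1]), 1 => //=.
exists d => // x sx; apply: le_lt_trans h; apply: ub_le_sup; last by exists x.
exact: (slice_has_sup bS d0).2.
Qed.

Lemma sub_slice d e : d <= e -> slice d `<=` slice e.
Proof. by move=> de x [x1 h]; split => //; rewrite (le_lt_trans _ h)// lerB. Qed.

(** * Functionals on operators and the set [W(T)] *)

Definition op_linear (f : (X -> Y) -> K) : Prop :=
  forall a S U, bounded_op S -> bounded_op U ->
    f (fun x => a *: S x + U x) = a * f S + f U.

Lemma op_linearZ f a S : op_linear f -> bounded_op S ->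
  f (fun x => a *: S x) = a * f S.
Proof.
move=> flin bS; have b0 := bounded_op0 X Y.
have f0 : f (fun=> 0) = 0.
  have := flin (-1) _ _ b0 b0.
  have -> : (fun x : X => -1 *: (0 : Y) + 0) = (fun=> 0).
    by apply/funext => x; rewrite scaler0 addr0.
  by rewrite mulN1r addNr.
rewrite -[RHS]addr0 -f0 -flin//; congr f.
by apply/funext => x; rewrite addr0.
Qed.

Lemma Gnorm_ge0 S : bounded_op S -> 0 <= Gn S.
Proof.
move=> bS; apply: lb_le_inf.
  by exists (sup [set nrm (S x) | x in slice 1]), 1 => //=.
move=> _ [d d0 <-]; have [x sx] := slice_nonempty d0.
rewrite (le_trans (nrm_ge0 rp (S x)))//; apply: ub_le_sup; last by exists x.
exact: (slice_has_sup bS d0).2.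
Qed.

(** For the norm bound, pick a slice on which [nrm (S x) < Gn S + e]. As [nrm (G (xs i))] tends to
    1, the points [xs i] eventually lie in it, and the [ys i] do not increase norms. *)
Lemma W_set_support T phi : bounded_op T -> W_set re G T phi ->
  [/\ phi T = 1,
      op_linear phi &
      forall S, bounded_op S -> nrm (phi S) <= Gn S].
Proof.
move=> bT [I [le [xs [ys [dle sph Gx Tx phix]]]]].
have ysD i : dual_sphere re (ys i) by exact: set_mem (sph i).2.
split.
- exact: (net_cvg_unique rp dle (phix T bT) Tx).
- move=> a S U bS bU.
  have bSU : bounded_op (fun x => a *: S x + U x).
    by apply: bounded_opD => //; exact: bounded_opZ.
  apply: (net_cvg_unique rp dle (phix _ bSU)).
  have -> : (fun i => psi (xs i) (ys i) (fun x => a *: S x + U x)) =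
      (fun i => a * psi (xs i) (ys i) S + psi (xs i) (ys i) U).
    by apply/funext => i; rewrite /psi (ysD i).1.1.
  exact: (net_cvg_linear rp a dle (phix _ bS) (phix _ bU)).
- move=> S bS; rewrite -subr_le0.
  apply: (@le0_of_le_eps _ _ 1) => e e0; rewrite mul1r lerBlDl.
  have [|d d0 hd] := @Gnorm_lt_slice S (Gn S + e) bS; first by rewrite ltrDl.
  apply: (net_cvg_le rp dle (phix _ bS)).
  have [i0 hi] := Gx d d0; exists i0 => i /hi h.
  rewrite (le_trans (dual_sphere_le rp _ (ysD i)))// ltW// hd//.
  by split; [exact: (sph i).1|move: h; rewrite ltr_norml => /andP[]; lra].
Qed.

(* Directional derivative of the norm: the norm of [T + t S] is nearly attained
   at some [x_t], and a functional norming [(T + t S) x_t] nearly norms [T x_t]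
   while its value at [S x_t] is at least [r - O(t)]. *)
Lemma near_support (S T : X -> Y) (r t M : R) :
  bounded_op S -> bounded_op T -> Gn T = 1 ->
  0 < t -> t * (`|r| + 1) < 1 -> (forall x, nrm (S x) <= M * nrm x) ->
  1 + t * r <= Gn (fun x => emb rp t *: S x + T x) ->
  exists (x : X) (y' : Y -> K),
    [/\ slice t x, dual_sphere re y', nrm (T x) < 1 + t ^+ 2,
        r - 2 * t <= re (y' (S x)) & 1 + t * r - t ^+ 2 - t * M <= re (y' (T x))].
Proof.
move=> bS bT T1 t0 tr SM Grt.
have t1 : t <= 1.
  rewrite leNgt; apply/negP => t1; have := normr_ge0 r; nra.
have bSU : bounded_op (fun x => emb rp t *: S x + T x).
  by apply: bounded_opD => //; exact: bounded_opZ.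
have t20 : 0 < t ^+ 2 by rewrite exprn_gt0.
(* Errors of size [t ^+ 2] survive division by [t]: from [1 + t * r - t ^+ 2 < t * re (y' (S x)) +
   re (y' (T x))] and [re (y' (T x)) < 1 + t ^+ 2] follows [r - 2 * t < re (y' (S x))]. *)
have [|d d0 hd] := @Gnorm_lt_slice T (1 + t ^+ 2) bT; first by rewrite T1 ltrDl.
have m0 : 0 < Num.min d t by rewrite lt_min d0.
have [|x sx hx] := @Gnorm_approx _ (1 + t * r - t ^+ 2) _ bSU _ m0.
  by rewrite (lt_le_trans _ Grt)// ltrBlDr ltrDl.
have sd : slice d x by apply: sub_slice sx; rewrite ge_min lexx.
have st : slice t x by apply: sub_slice sx; rewrite ge_min lexx orbT.
set z := emb rp t *: S x + T x in hx.
(* The assumption [t * (|r| + 1) < 1] gives [1 + t * r - t ^+ 2 > t - t ^+ 2 >= 0]. *)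
have z0 : z != 0.
  rewrite -(nrm_gt0 rp) (le_lt_trans _ hx)//.
  have := ler_norm (- r); rewrite normrN; nra.
have [y' dy' y'z] := norming_functional rp z0.
have y'E : re (y' z) = t * re (y' (S x)) + re (y' (T x)).
  by rewrite dy'.1.1 (reD rp) re_embM.
have hS : re (y' (S x)) <= M.
  rewrite (le_trans (re_le_norm rp _))// (le_trans (dual_sphere_le rp _ dy'))//.
  by rewrite (le_trans (SM x))// (set_mem st.1) (re1 rp) mulr1.
have hT : re (y' (T x)) < 1 + t ^+ 2.
  rewrite (le_lt_trans _ (hd x sd))// (le_trans (re_le_norm rp _))//.
  exact: (dual_sphere_le rp (T x) dy').
exists x, y'; split => //; first exact: hd.
  rewrite -(ler_pM2l t0); rewrite -y'z y'E in hx.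
  nra.
rewrite -y'z y'E in hx; have := ler_wpM2l (ltW t0) hS; lra.
Qed.

(** The hypothesis bounds from below the one-sided derivative of the norm at [T] in the direction
    [S]. An ultrafilter limit of the pairs from [near_support] is the required functional, and the
    net of the ultrafilter places it in [W(T)]. *)
Lemma W_set_derivative (S T : X -> Y) (r : R) :
  bounded_op S -> bounded_op T -> Gn T = 1 ->
  (forall t : R, 0 < t -> 1 + t * r <= Gn (fun x => emb rp t *: S x + T x)) ->
  exists2 phi, W_set re G T phi & r <= re (phi S).
Proof.
move=> bS bT T1 der.
have [M M0 SM] := bounded_op_le rp bS.
(* The shift [n.+2] makes [t n * (|r| + 1) < 1] strict already at [n = 0]. *)
pose t n : R := (n.+2%:R + `|r|)^-1.
have den0 n : 0 < n.+2%:R + `|r| :> R by rewrite ltr_pwDl.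
have t0 n : 0 < t n by rewrite invr_gt0.
have tr n : t n * (`|r| + 1) < 1.
  by rewrite mulrC ltr_pdivrMr// mul1r addrC ltrD2r ltr1n.
have /choice[xy xyP] : forall n, exists p : X * (Y -> K),
    [/\ slice (t n) p.1, dual_sphere re p.2, nrm (T p.1) < 1 + t n ^+ 2,
        r - 2 * t n <= re (p.2 (S p.1)) &
        1 + t n * r - t n ^+ 2 - t n * M <= re (p.2 (T p.1))].
  move=> n.
  have [x [y' h]] := near_support bS bT T1 (t0 n) (tr n) SM (der _ (t0 n)).
  by exists (x, y').
have x1 n : unit_sphere (xy n).1 by have [[/set_mem]] := xyP n.
have yD n : dual_sphere re (xy n).2 by have [] := xyP n.
(* Containing [\oo], the ultrafilter sends [t n] to 0; being maximal, it gives limits for all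
   bounded operators at once. *)
have [U [UU ooU]] := @ultraFilterLemma nat \oo _.
have tU e : 0 < e -> U [set n | t n < e].
  move=> e0; apply: ooU; exists (Num.truncn e^-1) => // n /= hn.
  rewrite -[e]invrK ltf_pV2 ?posrE ?invr_gt0// (lt_le_trans (truncnS_gt _))//.
  by rewrite (@le_trans _ _ n.+2%:R) ?lerDl// ler_nat ltnS (leq_trans hn).
have lims Q : bounded_op Q ->
    exists l, forall e, 0 < e -> U [set n | nrm ((xy n).2 (Q (xy n).1) - l) < e].
  move=> bQ; have [N N0 QN] := bounded_op_le rp bQ.
  apply: (re_ultra_cvg rp (M := N)) => n.
  rewrite (le_trans (dual_sphere_le rp _ (yD n)))// (le_trans (QN _))//.
  by rewrite x1 (re1 rp) mulr1.
pose phi Q :=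
  if pselect (bounded_op Q) is left bQ then sval (cid (lims Q bQ)) else 0.
have phiP Q : bounded_op Q -> forall e, 0 < e ->
    U [set n | nrm ((xy n).2 (Q (xy n).1) - phi Q) < e].
  by move=> bQ; rewrite /phi; case: pselect => // bQ'; case: cid.
(* Lower bounds with an error of order [t n] pass to the limit. *)
have re_phi Q c C : bounded_op Q ->
    (forall n, c - C * t n <= re ((xy n).2 (Q (xy n).1))) -> c <= re (phi Q).
  move=> bQ h; rewrite -subr_le0; apply: (@le0_of_le_eps _ _ (1 + `|C|)) => e e0.
  have [n [/= h1 h2]] := filter_ex (filterI (phiP Q bQ e e0) (tU e e0)).
  have := re_le_norm rp ((xy n).2 (Q (xy n).1) - phi Q).
  rewrite (reD rp) (reN rp) => h3.
  have := h n; have := ler_wpM2r (ltW (t0 n)) (ler_norm C).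
  have := ler_wpM2l (normr_ge0 C) (ltW h2); lra.
(* It suffices that [nrm (phi T) <= 1 <= re (phi T)], since a scalar whose real part reaches its
   norm equals that norm. *)
have phiT : phi T = 1.
  have T_le : nrm (phi T) <= 1.
    rewrite -subr_le0; apply: (@le0_of_le_eps _ _ 2) => e e0.
    have [n [/= h1 h2]] := filter_ex (filterI (phiP T bT e e0) (tU e e0)).
    have := nrm_triangle rp ((xy n).2 (T (xy n).1))
      (- ((xy n).2 (T (xy n).1) - phi T)).
    rewrite normrN opprB addrCA subrr addr0 => h3.
    have := dual_sphere_le rp (T (xy n).1) (yD n).
    have [_ _ h4 _ _] := xyP n.
    have : t n ^+ 2 <= t n.
      have := tr n; have := normr_ge0 r; have := t0 n; nra.
    lra.
  have T_ge : 1 <= re (phi T).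
    (* The three summands absorb [t n * r], [t n ^+ 2 <= t n] and [t n * M]. *)
    apply: (@re_phi T 1 (`|r| + 1 + M)) => // n; have [_ _ _ _] := xyP n.
    apply: le_trans.
    have : t n ^+ 2 <= t n.
      have := tr n; have := normr_ge0 r; have := t0 n; nra.
    have := ler_wpM2l (ltW (t0 n)) (ler_norm (- r)); rewrite normrN; lra.
  have h1 := re_le_norm rp (phi T).
  have phiTn : phi T = `|phi T| by apply: (re_norm_eq rp); lra.
  have n1 : nrm (phi T) = 1 by lra.
  by rewrite phiTn (nrmE rp) n1 rmorph1.
exists phi; last first.
  by apply: (@re_phi S r 2) => // n; have [_ _ _ + _] := xyP n; lra.
have PU : ProperFilter U by exact: ultra_proper.
exists (filter_index U), (@filter_index_le _ U),
  (fun i => (xy (sval i).2).1), (fun i => (xy (sval i).2).2).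
have psicvg Q : bounded_op Q -> net_cvg (@filter_index_le _ U)
    (fun i => psi (xy (sval i).2).1 (xy (sval i).2).2 Q) (phi Q).
  move=> bQ; apply/(net_cvgP rp) => e e0.
  exact: filter_index_eventually (phiP Q bQ e e0).
split => //.
- exact: filter_index_directed.
- by move=> i; split; rewrite inE; [exact: x1|exact: yD].
- move=> e e0; have [i0 hi] := filter_index_eventually PU (tU e e0).
  exists i0 => i /hi /= h; have [[_ h1] _ _ _ _] := xyP (sval i).2.
  rewrite ltr_norml; have := opnorm1_le (x1 (sval i).2); lra.
- by rewrite -phiT; exact: psicvg.
Qed.

(** Homogeneity of the G-norm scales [S] to norm one, where the dual norm bounds [g]. If [Gn S = 0],
    the bound [C * Gn S] is already zero. *)
Lemma Gdual_sphere_le g S : Gnorm_is_norm re G -> Gdual_sphere re G g ->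
  bounded_op S -> nrm (g S) <= Gn S.
Proof.
move=> [_ GnZ _] [[glin [C gC]] g1] bS.
have := Gnorm_ge0 bS; rewrite le_eqVlt => /predU1P[G0|G0].
  by rewrite (le_trans (gC _ bS))// -G0 mulr0.
pose a := emb rp (Gn S)^-1.
have na : nrm a = (Gn S)^-1 by rewrite nrm_emb// invr_ge0 ltW.
suff : nrm (g (fun x => a *: S x)) <= 1.
  by rewrite op_linearZ// (nrmM rp) na mulrC ler_pdivrMr// mul1r.
rewrite -g1; apply: ub_le_sup.
  exists `|C| => _ [U [bU U1] <-]; rewrite (le_trans (gC _ bU))//.
  rewrite (le_trans (ler_wpM2r (Gnorm_ge0 bU) (ler_norm C)))//.
  by rewrite ler_piMr.
exists (fun x => a *: S x) => //; split; first exact: bounded_opZ.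
by rewrite GnZ// na mulVf// gt_eqF.
Qed.

Lemma W_set_Gdual_sphere T phi : bounded_op T -> Gn T = 1 ->
  W_set re G T phi -> Gdual_sphere re G phi.
Proof.
move=> bT T1 /(W_set_support bT)[phiT phiL phile]; split.
  by split => //; exists 1 => S bS; rewrite mul1r; exact: phile.
have ub1 : ubound [set nrm (phi S) | S in [set S | bounded_op S /\ Gn S <= 1]] 1.
  by move=> _ [S [bS S1] <-]; rewrite (le_trans (phile _ bS)).
(* The dual norm 1 is attained at [T] itself. *)
have T_in : [set nrm (phi S) | S in [set S | bounded_op S /\ Gn S <= 1]] 1.
  by exists T; [rewrite /= T1|rewrite phiT (nrm1 rp)].
apply/eqP; rewrite eq_le; apply/andP; split.
  by apply: ge_sup => //; exists 1.
by apply: ub_le_sup => //; exists 1.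
Qed.

(** With [c] the phase of [g S - f S], the inequality at [c *: S] says that
    [nrm (g S - f S) <= 0]. *)
Lemma op_linear_re_le (f g : (X -> Y) -> K) : op_linear f -> op_linear g ->
  (forall S, bounded_op S -> re (g S) <= re (f S)) ->
  forall S, bounded_op S -> g S = f S.
Proof.
move=> fl gl fg S bS.
apply/eqP; rewrite -subr_eq0 -(nrm_eq0 rp) eq_le (nrm_ge0 rp) andbT.
have [c _ <-] := exists_phase rp (g S - f S).
rewrite mulrBr -!op_linearZ// (reD rp) (reN rp) subr_le0.
by apply: fg; exact: bounded_opZ.
Qed.

Theorem smooth_iff_W_singleton T : Gnorm_is_norm re G -> bounded_op T ->
  Gn T = 1 ->
  smooth_point re G T <->
  exists phi, W_singleton re G T phi /\ phi T = 1.
Proof.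
move=> Gnn bT T1; split.
- move=> [_ [f [_ [_ funiq]]]].
  (* The direction [S = 0] with [r = 0] shows that [W(T)] is nonempty. *)
  have [|t t0|phi Wphi _] := @W_set_derivative (fun=> 0) T 0 _ bT T1.
  + exact: bounded_op0.
  + rewrite mulr0 addr0.
    have -> : (fun x => emb rp t *: (0 : Y) + T x) = T.
      by apply/funext => x; rewrite scaler0 add0r.
    by rewrite T1.
  have supp psi : W_set re G T psi -> forall S, bounded_op S -> psi S = f S.
    move=> Wpsi; apply: funiq.
      by rewrite inE; exact: (W_set_Gdual_sphere bT T1).
    by have [] := W_set_support bT Wpsi.
  exists phi; split; last by have [] := W_set_support bT Wphi.
  split; first by rewrite inE.
  by move=> psi /set_mem Wpsi S bS; rewrite !supp.
- move=> [phi [[/set_mem Wphi phiuniq] phiT]]; split => //.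
  exists phi; split; first by rewrite inE; exact: (W_set_Gdual_sphere bT T1).
  split => // g /set_mem gsph gT.
  have [_ phiL _] := W_set_support bT Wphi.
  have gL := gsph.1.1.
  apply: op_linear_re_le => // S bS.
  have [t t0|psi Wpsi rpsi] := @W_set_derivative S T (re (g S)) bS bT T1.
    have bSU : bounded_op (fun x => emb rp t *: S x + T x).
      by apply: bounded_opD => //; exact: bounded_opZ.
    rewrite (le_trans _ (Gdual_sphere_le Gnn gsph bSU))//.
    rewrite (le_trans _ (re_le_norm rp _))// gL// gT (reD rp) re_embM (re1 rp).
    by rewrite addrC.
  by rewrite -(phiuniq psi)// inE.
Qed.
End GNorm.

(* K = R (real case, toR = id) and K = R[i] (complex case, toR = Re). *)
Theorem theorem3p11 (R : realType) :
  thm311_claim (K := R) (@id R) /\ thm311_claim (K := R[i]) (@Re R).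
Proof.
split => X Y G T bG G1 Gnn bT T1.
  exact: (smooth_iff_W_singleton (real_part_real R)).
exact: (smooth_iff_W_singleton (real_part_complex R)).
Qed.
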